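(* Let $n \geq 2$ be an integer and let $(X,d)$ be a complete metric space with $|X| \geq n$. Let $T\colon X \to X$ be an $n$-point Kannan-type mapping. If $T$ does not have periodic points of prime periods $2, 3, \dots, n-1$, then $T$ has a fixed point in $X$. Moreover, $T$ can admit at most $n-1$ fixed points.
   Context: $|X|$ denotes the cardinality of $X$. For points $x_1,\dots,x_n$ of a metric space $(X,d)$ put $S(x_1,\dots,x_n)=\sum_{1\le i<j\le n} d(x_i,x_j)$. For an integer $n$ with $2\le n\le |X|$, a mapping $T\colon X\to X$ is called an $n$-point Kannan-type mapping if there exists $\lambda\in[0,\frac{n-1}{n})$ such that $S(Tx_1,\dots,Tx_n)\le \lambda\sum_{i=1}^n d(x_i,Tx_i)$ for all pairwise distinct points $x_1,\dots,x_n\in X$. A point $x\in X$ is a periodic point of period $k$ of $T$ if $T^k(x)=x$; the least positive integer $k$ with $T^k(x)=x$ is called the prime period of $x$. (For $n=2$ the list of periods $2,\dots,n-1$ is empty.) *)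

(* Defs.v *)
From HB Require Import structures.
From mathcomp Require Import all_boot all_order all_algebra.
From mathcomp Require Import boolp classical_sets functions cardinality reals.
From mathcomp Require Import topology.

Set Implicit Arguments.
Unset Strict Implicit.
Unset Printing Implicit Defensive.

Import Order.TTheory GRing.Theory Num.Theory.
Local Open Scope classical_set_scope.
Local Open Scope ring_scope.

(* [Complete] is completeness of the uniformity induced by the metric; in the
   library it comes with a distinguished point, so these spaces are nonempty. *)
#[short(type="completeMetricType")]
HB.structure Definition CompleteMetric (R : numDomainType) :=
  {X of Complete X & Metric R X}.

Definition dist_sum (R : realType) (X : metricType R) (n : nat)
    (x : 'I_n -> X) : R :=
  \sum_(i < n) \sum_(j < n | (i < j)%N) mdist (x i) (x j).

(* Pairwise distinct x_1, ..., x_n are an injective family indexed by 'I_n. *)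
Definition kannan_type (R : realType) (X : metricType R) (n : nat)
    (T : X -> X) : Prop :=
  exists lambda : R, 0 <= lambda < (n%:R - 1) / n%:R /\
    forall x : 'I_n -> X, injective x ->
      dist_sum (fun i => T (x i)) <=
        lambda * \sum_(i < n) mdist (x i) (T (x i)).

Definition periodic_point (X : Type) (T : X -> X) (k : nat) (x : X) : Prop :=
  iter k T x = x.

Definition prime_period (X : Type) (T : X -> X) (k : nat) (x : X) : Prop :=
  [/\ (0 < k)%N, periodic_point T k x &
      forall j : nat, (0 < j)%N -> periodic_point T j x -> (k <= j)%N].

(* Main.v *)
(* For n points, S is at least (n-1) times the distance of any two of them: add
   up the triangle inequalities through each of the other points. If T had
   neither a fixed point nor a prime period in [2, n-1], any n consecutive orbit
   points would be distinct, so with a_k = d(T^k x, T^(k+1) x) the Kannan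
   condition gives (n-1) a_(k+n-1) <= lambda (a_k + ... + a_(k+n-1)). As
   lambda < (n-1)/n, a_k decays geometrically and the orbit converges to some z;
   the condition for n-1 late orbit points together with z forces T z = z.
   For n distinct fixed points the right-hand side would vanish while S > 0. *)

Require Import Defs.
From HB Require Import structures.
From mathcomp Require Import all_boot all_order all_algebra.
From mathcomp Require Import boolp classical_sets functions cardinality reals.
From mathcomp Require Import topology.
From mathcomp Require Import normedtype sequences ring lra zify.

Import Order.TTheory GRing.Theory Num.Theory.
Import numFieldNormedType.Exports.
Local Open Scope classical_set_scope.
Local Open Scope card_scope.
Local Open Scope ring_scope.

Lemma bernoulli_inequality (R : realDomainType) (d : R) (n : nat) :
  0 <= d <= 1 -> 1 - n%:R * d <= (1 - d) ^+ n.
Proof.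
move=> /andP[d0 d1]; elim: n => [|n IH]; first by rewrite mul0r subr0 expr0.
rewrite exprS.
have n0 : 0 <= n%:R :> R by rewrite ler0n.
have /(le_trans _) : (1 - d) * (1 - n%:R * d) <= (1 - d) * (1 - d) ^+ n.
  by rewrite ler_wpM2l// subr_ge0.
apply; rewrite -natr1; nra.
Qed.

(* The recursion bounds (p - lambda) a_(k+p) by lambda (a_k + ... + a_(k+p-1)).
   A rate rho works once lambda p <= (p - lambda) rho^p, which Bernoulli's
   inequality gives for rho close to 1, because lambda p < p - lambda. *)
Lemma averaging_decay (R : realFieldType) (a : nat -> R) (p : nat) (l : R) :
  (0 < p)%N -> 0 <= l < p%:R / p.+1%:R -> (forall k, 0 <= a k) ->
  (forall k, p%:R * a (k + p)%N <= l * \sum_(i < p.+1) a (k + i)%N) ->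
  exists C rho : R, [/\ 0 < rho, rho < 1 & forall k, a k <= C * rho ^+ k].
Proof.
move=> p_gt0 /andP[l0]; rewrite ltr_pdivlMr ?ltr0n// -natr1 => lp a0 rec.
have p1 : 1 <= p%:R :> R by rewrite ler1n.
set q : R := p%:R in rec lp p1.
have q20 : 0 < 2 * q ^+ 2 by nra.
(* Half of the slack [q - l - l * q] has to pay for [(q - l) * (q * d)], which is at most
   [q ^+ 2 * d]. The factor 2 also keeps [1 - d] positive when [q = 1] and [l = 0]. *)
pose d := (q - l - l * q) / (2 * q ^+ 2).
have dE : d * (2 * q ^+ 2) = q - l - l * q by rewrite /d divfK// gt_eqF.
have d0 : 0 < d by rewrite /d divr_gt0//; lra.
have d1 : d < 1 by rewrite /d ltr_pdivrMr//; nra.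
have lq : l < q by nra.
have rho_gt0 : 0 < 1 - d by lra.
have rho_ge0 := ltW rho_gt0.
have rho_le1 : 1 - d <= 1 by lra.
have rate : l * q <= (q - l) * (1 - d) ^+ p.
  have /(_ p) := @bernoulli_inequality R d; rewrite ltW//= ltW// -/q.
  move=> /(_ isT) B.
  have /(le_trans _) : (q - l) * (1 - q * d) <= (q - l) * (1 - d) ^+ p.
    by rewrite ler_wpM2l// subr_ge0 ltW.
  apply.
  have : 0 <= l * (q * d) by apply: mulr_ge0 => //; rewrite mulr_ge0 ?(ltW d0)// (le_trans ler01).
  nra.
(* Chosen to settle the indices below [p], which the recursion does not reach. *)
pose C := (\sum_(i < p) a i) / (1 - d) ^+ p.
have C0 : 0 <= C.
  by rewrite /C divr_ge0 ?exprn_ge0// sumr_ge0.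
exists C, (1 - d); split => //; first by lra.
elim/ltn_ind => k IH; case: (ltnP k p) => kp.
  rewrite /C mulrAC ler_pdivlMr ?exprn_gt0//.
  apply: ler_pM => //; rewrite ?exprn_ge0//.
    by rewrite (bigD1 (Ordinal kp))//= lerDl sumr_ge0.
  by rewrite ler_wiXn2l// ltnW.
have [j kE] : exists j, k = (j + p)%N by exists (k - p)%N; rewrite subnK.
rewrite {}kE {kp k} in IH *.
rewrite -(ler_pM2l (_ : 0 < q - l)) ?subr_gt0//.
have sum_le : \sum_(i < p) a (j + i)%N <= q * (C * (1 - d) ^+ j).
  rewrite mulr_natl -[X in _ *+ X]card_ord -sumr_const.
  apply: ler_sum => i _; apply: (le_trans (IH _ _)); first by rewrite ltn_add2l.
  by rewrite ler_wpM2l// ler_wiXn2l// leq_addr.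
have := rec j; rewrite big_ord_recr/= => recj.
have lsum := ler_wpM2l l0 sum_le.
have Cj0 : 0 <= C * (1 - d) ^+ j by rewrite mulr_ge0// exprn_ge0.
have := ler_wpM2r Cj0 rate; rewrite exprD => rateC.
have -> : (q - l) * (C * ((1 - d) ^+ j * (1 - d) ^+ p)) =
  (q - l) * (1 - d) ^+ p * (C * (1 - d) ^+ j) by ring.
apply: le_trans rateC; lra.
Qed.

(** With [D = C / (1 - rho)], the bound on step [k] equals [D * rho ^+ k - D * rho ^+ k.+1]. The
    bounds telescope, so all points after index [i] lie within [D * rho ^+ i] of [u i]. *)
Lemma geometric_steps_cvg (R : realType) (X : completeMetricType R)
    (u : nat -> X) (C rho : R) :
  0 < rho -> rho < 1 -> (forall k, mdist (u k) (u k.+1) <= C * rho ^+ k) ->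
  exists z : X, u @ \oo --> z.
Proof.
move=> r0 r1 step.
have C0 : 0 <= C by have := le_trans (mdist_ge0 _ _) (step 0%N); rewrite mulr1.
pose D := C / (1 - rho).
have DE : D * (1 - rho) = C by rewrite divfK// gt_eqF// subr_gt0.
have D0 : 0 <= D by rewrite divr_ge0// subr_ge0 ltW.
have tele i k : mdist (u i) (u (i + k)%N) <= D * rho ^+ i - D * rho ^+ (i + k).
  elim: k => [|k IH]; first by rewrite addn0 mdistxx subrr.
  apply: (le_trans (metric_triangle _ (u (i + k)%N) _)).
  have := step (i + k)%N; rewrite addnS exprS -DE; nra.
have tail i j : (i <= j)%N -> mdist (u i) (u j) <= D * rho ^+ i.
  move=> ij; rewrite -(subnKC ij); apply: (le_trans (tele _ _)).
  by rewrite gerBl mulr_ge0// exprn_ge0// ltW.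
suff /cauchy_cvgP cu : cauchy (u @ \oo) by apply/cvg_ex.
apply: cauchy_exP => e e0.
have [N _ HN] : \forall k \near \oo, D * rho ^+ k < e.
  have := @cvg_geometric R D rho; rewrite ger0_norm ?ltW// => /(_ r1).
  move=> /cvgrPdist_lt/(_ _ e0).
  apply: filterS => k; rewrite sub0r normrN ger0_norm//.
  by rewrite mulr_ge0// exprn_ge0// ltW.
exists (u N), N => // k /= Nk; rewrite ballEmdist/=.
by apply: le_lt_trans (tail _ _ Nk) (HN _ _) => /=.
Qed.

Lemma dist_sum_recr (R : realType) (X : metricType R) (x : nat -> X) (n : nat) :
  dist_sum (fun i : 'I_n.+1 => x i) =
  dist_sum (fun i : 'I_n => x i) + \sum_(i < n) mdist (x i) (x n).
Proof.
rewrite /dist_sum big_ord_recr/= [X in _ + X]big_pred0 ?addr0; last first.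
  by move=> j; rewrite ltnNge -ltnS ltn_ord.
rewrite -big_split/=; apply: eq_bigr => i _.
by rewrite big_mkcond big_ord_recr/= ltn_ord -big_mkcond.
Qed.

Lemma dist_sum_ge0 (R : realType) (X : metricType R) (n : nat) (x : 'I_n -> X) :
  0 <= dist_sum x.
Proof. by do 2!(apply: sumr_ge0 => ? _); exact: mdist_ge0. Qed.

(* Each of the m other points contributes its distances to the last two, which
   together are at least the distance between these two. *)
Lemma dist_sum_ge_last (R : realType) (X : metricType R) (x : nat -> X)
    (m : nat) :
  m.+1%:R * mdist (x m) (x m.+1) <= dist_sum (fun i : 'I_m.+2 => x i).
Proof.
rewrite 2!dist_sum_recr big_ord_recr/= -natr1 mulrDl mul1r !addrA lerD2r.
rewrite -addrA -big_split/= -[leLHS]add0r; apply: lerD.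
  exact: dist_sum_ge0.
rewrite mulr_natl -[X in _ *+ X]card_ord -sumr_const; apply: ler_sum => i _.
by rewrite [X in _ <= X + _]metric_sym metric_triangle.
Qed.

(** The only form of the Kannan condition used below, with [n = m.+2]. Families become sequences
    injective below [m.+2], so that orbit windows can be plugged in directly. *)
Lemma kannan_last (R : realType) (X : metricType R) (m : nat) (T : X -> X) :
  kannan_type m.+2 T ->
  exists l : R, 0 <= l < m.+1%:R / m.+2%:R /\
    forall y : nat -> X, {in gtn m.+2 &, injective y} ->
      m.+1%:R * mdist (T (y m)) (T (y m.+1)) <=
        l * \sum_(i < m.+2) mdist (y i) (T (y i)).
Proof.
move=> [l [lE K]]; exists l; split; first by rewrite -[m.+1%:R](addrK 1) natr1.
move=> y yI; apply: le_trans (K (fun i => y i) _); last first.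
  by move=> i j /yI ij; apply: val_inj; apply: ij; rewrite !inE ltn_ord.
exact: (@dist_sum_ge_last R X (fun i => T (y i))).
Qed.

(** The earlier iterate returns to itself after [j - i] steps; its least positive return time is the
    prime period. *)
Lemma iter_collision_prime_period (X : Type) (T : X -> X) (x : X) (i j : nat) :
  (i < j)%N -> iter i T x = iter j T x ->
  exists2 k, (0 < k <= j - i)%N & prime_period T k (iter i T x).
Proof.
move=> ij E; set y := iter i T x.
have ex : exists k, `[< (0 < k)%N /\ iter k T y = y >].
  exists (j - i)%N; apply/asboolP; split; first by rewrite subn_gt0.
  by rewrite /y -iterD subnK// ltnW.
case: (ex_minnP ex) => k /asboolP[k0 kE] kmin.
exists k.
  rewrite k0 kmin//; apply/asboolP; split; first by rewrite subn_gt0.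
  by rewrite /y -iterD subnK// ltnW.
by split => // h h0 hE; apply: kmin; apply/asboolP.
Qed.

(** A collision among [n] consecutive iterates would give a prime period of at most [n - 1]: either
    1, a fixed point, or one of the excluded periods. *)
Lemma orbit_window_inj (X : Type) (T : X -> X) (n : nat) (x : X) (k : nat) :
  (forall h : nat, (2 <= h <= n - 1)%N -> ~ exists x, prime_period T h x) ->
  (forall x, T x <> x) -> {in gtn n &, injective (fun i => iter (k + i) T x)}.
Proof.
move=> noper nofix.
have lt_neq i j : (i < j < n)%N -> iter (k + i) T x <> iter (k + j) T x.
  move=> /andP[ij jn] E.
  have kij : (k + i < k + j)%N by rewrite ltn_add2l.
  have [h] := @iter_collision_prime_period X T x _ _ kij E.
  rewrite subnDl => /andP[h0 hij] hper.
  have [h1|h1] := leqP h 1.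
    have hE : h = 1%N by apply/eqP; rewrite eqn_leq h1.
    by case: hper => _; rewrite hE => /nofix.
  apply: (noper h); last by exists (iter (k + i) T x).
  by rewrite h1/= (leq_trans hij)//; lia.
move=> i j; rewrite !inE => iN jN /= E.
have [ij|ij|//] := ltngtP i j.
- by case: (lt_neq i j); rewrite ?ij.
- by case: (lt_neq j i); rewrite ?ij.
Qed.

Lemma kannan_orbit_cvg_fixed (R : realType) (X : metricType R) (m : nat)
    (T : X -> X) (l : R) (u : nat -> X) (z : X) :
  0 <= l < 1 ->
  (forall y : nat -> X, {in gtn m.+2 &, injective y} ->
     m.+1%:R * mdist (T (y m)) (T (y m.+1)) <=
       l * \sum_(i < m.+2) mdist (y i) (T (y i))) ->
  (forall k, u k.+1 = T (u k)) ->
  (forall k, {in gtn m.+2 &, injective (fun i => u (k + i)%N)}) ->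
  u @ \oo --> z -> T z = z.
Proof.
move=> /andP[l0 l1] K uS uI uz; apply: contrapT => Tz.
have D0 : 0 < mdist z (T z) by rewrite mdist_gt0; apply/eqP => /esym.
set D := mdist z (T z) in D0.
(* The final estimate loses at most [3 * e] against the gap [D * (1 - l)]; moreover [2 * e < D]. *)
pose e := D * (1 - l) / 6.
have e0 : 0 < e by rewrite /e !mulr_gt0//; lra.
have [N _ HN] := (metricType_numDomainType.cvgrPdist_lt u z).1 uz _ e0.
have near k : (N <= k)%N -> mdist z (u k) < e by move=> /HN.
have step k : (N <= k)%N -> mdist (u k) (T (u k)) < 2 * e.
  move=> Nk; rewrite -uS.
  apply: (le_lt_trans (metric_triangle _ z _)).
  rewrite metric_sym mulr_natl mulr2n ltrD// near// leqW//.
(* Late orbit points move by less than [2 * e], while [z] moves by [D]. Hence [z] can join them in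
   an injective family. *)
have uNz k : (N <= k)%N -> u k <> z.
  by move=> /step + E; rewrite E -/D /e => ?; nra.
pose y i := if i == m.+1 then z else u (N + i)%N.
have yI : {in gtn m.+2 &, injective y}.
  move=> i j iN jN; rewrite /y.
  case: eqP => [->|_]; case: eqP => [->|_] //.
  - by move=> /esym/uNz[]; rewrite leq_addr.
  - by move=> /uNz[]; rewrite leq_addr.
  - exact: uI.
have ylast : y m.+1 = z by rewrite /y eqxx.
have := K _ yI; rewrite big_ord_recr/= ylast -/D.
have -> : T (y m) = u (N + m.+1)%N by rewrite /y ltn_eqF// addnS uS.
set S := \sum_(i < _) _.
have S_le : S <= m.+1%:R * (2 * e).
  rewrite /S mulr_natl -[X in _ *+ X]card_ord -sumr_const; apply: ler_sum => i _.
  by rewrite /y ltn_eqF// ltW// step// leq_addr.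
have m1 : 1 <= m.+1%:R :> R by rewrite ler1n.
have tri := metric_triangle z (u (N + m.+1)%N) (T z).
have := near _ (leq_addr m.+1 N).
rewrite -/D in tri.
have eE : 6 * e = D * (1 - l) by rewrite /e; field.
set w := mdist (u _) (T z) in tri *; set v := mdist z (u _) in tri *.
set q : R := m.+1%:R in S_le m1 *; move=> ve.
have lS : l * S <= l * (q * (2 * e)) by rewrite ler_wpM2l.
move=> main.
(* Since [q >= 1], the single term [l * D] may be enlarged to [q * (l * D)], so that [q] cancels. *)
have : q * w <= q * (l * (2 * e + D)).
  apply: (le_trans main); rewrite mulrDr.
  have : 0 <= (q - 1) * (l * D) by rewrite !mulr_ge0// ?subr_ge0// ltW.
  lra.
rewrite ler_pM2l; last by lra.
nra.
Qed.

(** A finite [A] has some cardinality [k > n], and an infinite one contains a copy of the naturals;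
    either way [n.+1] indices embed in it. *)
Lemma not_card_le_injective (T : pointedType) (A : set T) (n : nat) :
  ~ (A #<= `I_n) ->
  exists f : nat -> T,
    {in gtn n.+1 &, injective f} /\ forall i, (i < n.+1)%N -> A (f i).
Proof.
move=> An.
have /pcard_leP[f] : `I_n.+1 #<= A.
  have [/finite_setP[k Ak]|/infiniteP] := pselect (finite_set A).
    rewrite (card_le_eqr Ak) card_le_II ltnNge.
    by apply/negP => kn; apply: An; rewrite (card_le_eql Ak) card_le_II.
  by apply: card_le_trans; exact: subset_card_le.
exists f; split; last by move=> i i_n; exact: (@funS _ _ _ _ f).
by move=> i j i_n j_n; apply: (@inj _ _ _ f); rewrite inE.
Qed.

Theorem theorem3p2 (R : realType) (X : completeMetricType R) (n : nat)
    (n_ge2 : (2 <= n)%N) (card_X : `I_n #<= [set: X])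
    (T : X -> X) (kannan_T : kannan_type n T) :
  ((forall k : nat, (2 <= k <= n - 1)%N ->
      ~ exists x : X, prime_period T k x) ->
    exists x : X, T x = x) /\
  [set x : X | T x = x] #<= `I_(n - 1).
Proof.
case: n n_ge2 card_X kannan_T => [//|[//|m]] _ _ /kannan_last[l [lE K]].
have l01 : 0 <= l < 1.
  case/andP: lE => -> /lt_trans; apply.
  by rewrite ltr_pdivrMr ?ltr0n// mul1r ltr_nat.
split=> [noper|].
  apply: contrapT => nofix.
  have {}nofix x : T x <> x by move=> Tx; apply: nofix; exists x.
  pose u k := iter k T (point : X).
  have uI k := @orbit_window_inj X T m.+2 point k noper nofix.
  have [|||C [rho [r0 r1 decay]]] :=
    @averaging_decay R (fun k => mdist (u k) (u k.+1)) m.+1 l _ lE.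
  - by [].
  - by move=> k; exact: mdist_ge0.
  (* The last two images of the window starting at [k] are the orbit points of indices [k + m.+1]
     and [k + m.+2]. *)
  - by move=> k; have := K _ (uI k); rewrite addnS.
  have [z uz] := @geometric_steps_cvg R X u C rho r0 r1 decay.
  by apply: (nofix z); exact: kannan_orbit_cvg_fixed l01 K _ uI uz.
rewrite subn1/=; apply: contrapT => /not_card_le_injective[f [fI fT]].
have := K f fI; rewrite big1 ?mulr0; last first.
  by move=> i _; rewrite fT// mdistxx.
rewrite !fT// leNgt mulr_gt0 ?ltr0n// mdist_gt0.
by apply/negP/negP/eqP => /fI; rewrite !inE => /(_ _ _)/n_Sn; apply.
Qed.
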